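(* Let $\hat\Omega\in\mathfrak{R}^n$, let $f:\hat\Omega\to\mathbb{R}^n$ and $G:\hat\Omega\to\mathbb{R}^{n\times m}$ with $f(0)=0$, and consider $\dot x=f(x)+G(x)u$, $x\in\hat\Omega$, with $u=\kappa(t)$ for $t\ge0$. Let $\mathcal{T}=\{\sigma_i\}_{i=1}^{m_{\mathcal{T}}}$, $\sigma_i=\mathrm{co}(\{x_{i,j}\}_{j=0}^n)$, be a triangulation of $\hat\Omega$ with $f,G\in\mathcal{C}^2(\mathcal{T})$. Let $\mathcal{A}_1\in\mathfrak{R}^n$ with $\mathcal{A}_1\subset\hat\Omega$ and $\partial\mathcal{A}_1$ contained in the union of the boundaries $\partial\sigma_i$, and let $\mathbb{I}_1=\{i\in\mathbb{Z}_1^{m_{\mathcal{T}}}:\sigma_i\not\subseteq\mathcal{A}_1\}$. For each $i$ let $\beta_i\ge\max_{p,q,r\in\mathbb{Z}_1^n}\max_{\xi\in\sigma_i}\big|\partial^2 f^{(p)}/\partial x^{(q)}\partial x^{(r)}(\xi)\big|$, let $\hat g_i=\max_{x\in\sigma_i}\|G(x)\|_\infty$, and let $c_{i,j}=\tfrac{n}{2}\|x_{i,j}-x_{i,0}\|_2(\max_{k\in\mathbb{Z}_1^n}\|x_{i,k}-x_{i,0}\|_2+\|x_{i,j}-x_{i,0}\|_2)$. For vertex values $\mathbf{W}=\{W_x\}_{x\in\mathbb{E}_{\mathcal{T}}}$, vectors $\hat{\mathbf{L}}=\{\hat l_i\}\subset\mathbb{R}^n$ and scalars $b_2,\hat u$,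 set $D^+_{i,j}W=f(x_{i,j})^\intercal\nabla W_i+(1_n^\intercal\hat l_i)(\beta_i c_{i,j}+\hat g_i\hat u)$. Then there exist $\mathbf{W},\hat{\mathbf{L}},b_2,\hat u$ satisfying (i) $\hat u>0$; (ii) $W_x>0$ for all $x\in\mathbb{E}_{\mathcal{T}}$; (iii) $|\nabla W_i|\le\hat l_i$ (componentwise) for all $i$; (iv) $D^+_{i,j}W\le -b_2$ for all $i\in\mathbb{I}_1$, $j\in\mathbb{Z}_0^n$. Suppose further that such values satisfy $b_2>0$ and that there is a sublevel set $\mathcal{A}=\{x\in\hat\Omega: W(x)\le c\}$ of the CPA interpolation $W$ of $\mathbf{W}$ with $\mathcal{A}_1\subset\mathcal{A}\subseteq\hat\Omega$. Then, provided $\|\kappa(t)\|_\infty\le\hat u$ for all $t\ge0$, the restriction of $W$ to $\mathcal{A}^\circ$ is a barrier function, i.e.: $W$ is Lipschitz, $W(x)>0$ for all $x\in\hat\Omega$, and $D^+W(x)\le -b_2$ for all $x\in(\hat\Omega\setminus\mathcal{A}_1)^\circ$, where $D^+W$ is the Dini derivative of $W$ along $\dot x=f(x)+G(x)u$ with $\|u\|_\infty\le\hat u$.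
   Context: $\mathfrak{R}^n$: compact sets $\Omega\subset\mathbb{R}^n$ with connected interior containing $0$ and $\Omega=\overline{\Omega^\circ}$. A triangulation of $\Omega$ is a finite collection of $n$-simplexes (convex hulls of $n+1$ affinely independent vertices) with union $\Omega$, any two meeting in a common face or not at all; $\mathbb{E}_{\mathcal{T}}$ is its vertex set; the vertex $x_{i,0}$ is arbitrary unless $0\in\sigma_i$, in which case $x_{i,0}=0$. $\mathcal{C}^2(\mathcal{T})$: continuous and $\mathcal{C}^2$ on each simplex. With $X_i$ the matrix with rows $(x_{i,j}-x_{i,0})^\intercal$ and $\bar W_i$ the vector with entries $W_{x_{i,j}}-W_{x_{i,0}}$, $\nabla W_i=X_i^{-1}\bar W_i$, and the CPA interpolation $W$ is the unique continuous function affine on each $\sigma_i$ with gradient $\nabla W_i$ and $W(x)=W_x$ at vertices. The Dini derivative is $D^+W(x)=\limsup_{h\to0^+}(W(x+h\,v)-W(x))/h$ with $v=f(x)+G(x)u$. $\|G\|_\infty$ is the induced $\infty$-norm, $1_n$ the all-ones vector, $|v|$ componentwise absolute value. *)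

(* Defs.v *)
From mathcomp Require Import all_boot all_order all_algebra.
From mathcomp Require Import all_classical all_reals all_analysis.
Import Order.TTheory GRing.Theory Num.Theory.
Import numFieldTopology.Exports numFieldNormedType.Exports.

Set Implicit Arguments.
Unset Strict Implicit.
Unset Printing Implicit Defensive.

Local Open Scope ring_scope.
Local Open Scope classical_set_scope.

Section Defs.
Context {R : realType}.

Definition norm2 {n} (x : 'rV[R]_n) : R := Num.sqrt (\sum_(k < n) x 0 k ^+ 2).
Definition norminf {n} (x : 'rV[R]_n) : R := \big[Num.max/0]_(k < n) `|x 0 k|.
Definition mxnorminf {n m} (A : 'M[R]_(n, m)) : R :=
  \big[Num.max/0]_(p < n) \sum_(k < m) `|A p k|.

Definition frakR {n} (O : set 'rV[R]_n) : Prop :=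
  [/\ compact O, connected (O°), (O°) 0 & O = closure (O°)].

Definition bdry {n} (S : set 'rV[R]_n) : set 'rV[R]_n := closure S `\` S°.

Definition conv_sub {n k} (v : 'I_k -> 'rV[R]_n) (S : {set 'I_k}) : set 'rV[R]_n :=
  [set y | exists lam : 'I_k -> R,
     [/\ forall j, 0 <= lam j, forall j, j \notin S -> lam j = 0,
         \sum_j lam j = 1 & y = \sum_j lam j *: v j]].

Definition simplex {n mT} (x : 'I_mT -> 'I_n.+1 -> 'rV[R]_n) (i : 'I_mT) :=
  conv_sub (x i) [set: 'I_n.+1]%SET.

Definition Xmat {n mT} (x : 'I_mT -> 'I_n.+1 -> 'rV[R]_n) (i : 'I_mT) : 'M[R]_n :=
  \matrix_(j < n, k < n) (x i (lift ord0 j) 0 k - x i ord0 0 k).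

Definition triangulation {n mT} (O : set 'rV[R]_n)
    (x : 'I_mT -> 'I_n.+1 -> 'rV[R]_n) : Prop :=
  [/\ (* each sigma_i is an n-simplex (affinely independent vertices) *)
      forall i, Xmat x i \in unitmx,
      [set y | exists i, simplex x i y] = O,
      (* it is a collection: distinct indices give distinct simplices *)
      forall i k, i != k -> simplex x i != simplex x k,
      forall i k, simplex x i `&` simplex x k = set0 \/
        exists (S S' : {set 'I_n.+1}), (0 < #|S|)%N /\ (0 < #|S'|)%N /\
          simplex x i `&` simplex x k = conv_sub (x i) S /\
          simplex x i `&` simplex x k = conv_sub (x k) S' &
      forall i, simplex x i 0 -> x i ord0 = 0].

Definition vertices {n mT} (x : 'I_mT -> 'I_n.+1 -> 'rV[R]_n) : set 'rV[R]_n :=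
  [set y | exists i j, y = x i j].

Definition ebasis {n} (q : 'I_n) : 'rV[R]_n := \row_k (k == q)%:R.

Definition partial {n} (h : 'rV[R]_n -> R) (q : 'I_n) : 'rV[R]_n -> R :=
  fun y => 'D_(ebasis q) h y.

Definition C2 {n} (h : 'rV[R]_n -> R) : Prop :=
  forall q r : 'I_n,
    [/\ forall y, derivable h y (ebasis q),
        continuous (partial h q),
        forall y, derivable (partial h q) y (ebasis r) &
        continuous (partial (partial h q) r)].

Definition C2_on {n} (S : set 'rV[R]_n) (h : 'rV[R]_n -> R) : Prop :=
  exists g, C2 g /\ forall y, S y -> g y = h y.

Definition pwC2 {n mT} (O : set 'rV[R]_n) (x : 'I_mT -> 'I_n.+1 -> 'rV[R]_n)
    (h : 'rV[R]_n -> R) : Prop :=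
  {within O, continuous h} /\ forall i, C2_on (simplex x i) h.

Definition Wbar {n mT} (x : 'I_mT -> 'I_n.+1 -> 'rV[R]_n) (Wv : 'rV[R]_n -> R)
    (i : 'I_mT) : 'cV[R]_n :=
  \col_(j < n) (Wv (x i (lift ord0 j)) - Wv (x i ord0)).

Definition gradW {n mT} (x : 'I_mT -> 'I_n.+1 -> 'rV[R]_n) (Wv : 'rV[R]_n -> R)
    (i : 'I_mT) : 'cV[R]_n :=
  invmx (Xmat x i) *m Wbar x Wv i.

(* W is the CPA interpolation of the vertex values Wv: on each sigma_i it is
   the affine function with gradient nabla W_i taking the value W_{x_{i,0}}
   at x_{i,0} (hence W_x at every vertex). Outside O it is unconstrained. *)
Definition is_CPA {n mT} (x : 'I_mT -> 'I_n.+1 -> 'rV[R]_n) (Wv : 'rV[R]_n -> R)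
    (W : 'rV[R]_n -> R) : Prop :=
  forall i y, simplex x i y ->
    W y = Wv (x i ord0) + \sum_(k < n) gradW x Wv i k 0 * (y 0 k - x i ord0 0 k).

Definition Gu {n m} (Gx : 'M[R]_(n, m)) (u : 'rV[R]_m) : 'rV[R]_n :=
  \row_(p < n) \sum_(k < m) Gx p k * u 0 k.

Definition dini {n} (W : 'rV[R]_n -> R) (y v : 'rV[R]_n) : \bar R :=
  limf_esup (fun h : R => ((W (y + h *: v) - W y) / h)%:E) (0^'+).

Definition cij {n mT} (x : 'I_mT -> 'I_n.+1 -> 'rV[R]_n) (i : 'I_mT) (j : 'I_n.+1) : R :=
  (n%:R / 2) * norm2 (x i j - x i ord0) *
  (\big[Num.max/0]_(k < n) norm2 (x i (lift ord0 k) - x i ord0)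
   + norm2 (x i j - x i ord0)).

Definition Dij {n mT} (x : 'I_mT -> 'I_n.+1 -> 'rV[R]_n) (f : 'rV[R]_n -> 'rV[R]_n)
    (beta ghat : 'I_mT -> R) (Wv : 'rV[R]_n -> R) (l : 'I_mT -> 'rV[R]_n)
    (uhat : R) (i : 'I_mT) (j : 'I_n.+1) : R :=
  \sum_(k < n) f (x i j) 0 k * gradW x Wv i k 0
  + (\sum_(k < n) l i 0 k) * (beta i * cij x i j + ghat i * uhat).

Definition barrier_conditions {n mT} (x : 'I_mT -> 'I_n.+1 -> 'rV[R]_n)
    (f : 'rV[R]_n -> 'rV[R]_n) (beta ghat : 'I_mT -> R) (A1 : set 'rV[R]_n)
    (Wv : 'rV[R]_n -> R) (l : 'I_mT -> 'rV[R]_n) (b2 uhat : R) : Prop :=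
  [/\ 0 < uhat,
      forall y, vertices x y -> 0 < Wv y,
      forall i (k : 'I_n), `|gradW x Wv i k 0| <= l i 0 k &
      forall i, ~ (simplex x i `<=` A1) ->
        forall j, Dij x f beta ghat Wv l uhat i j <= - b2].

End Defs.

(* Main.v *)
Require Import Defs.
From HB Require Import structures.
From mathcomp Require Import all_boot all_order all_algebra.
From mathcomp Require Import all_classical all_reals all_analysis.
From mathcomp Require Import ring lra.
Import Order.TTheory GRing.Theory Num.Theory.
Import numFieldTopology.Exports numFieldNormedType.Exports.

Local Open Scope ring_scope.
Local Open Scope classical_set_scope.

(* Existence is witnessed by a constant W, whose gradients vanish, with b2 = 0.

   For the barrier property, write a point of a simplex in barycentric
   coordinates. Second-order Taylor expansion of f at x_{i,0} bounds the error of
   interpolating f linearly from the vertices by beta_i sum_j lam_j c_{i,j}, so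
   that the convex combination of the inequalities D+_{i,j} W <= - b2 bounds
   (f + G u) . grad W_i on the whole simplex. A short ray issued from an interior
   point y of Omega \ A1 only meets simplexes containing y, along each of which W
   is affine; hence all small difference quotients are at most - b2.

   Omega need not be convex, so the Lipschitz bound compares two simplexes at a
   time: Farkas' lemma gives a vector eta with W y - W z <= eta . (y - z). *)

(** * Farkas' lemma *)

Section Farkas.
Context {R : realFieldType}.

(** Running minima over [B] and maxima over [A] also cover empty lists. In [farkas] this chooses the
    coefficient of the eliminated functional. *)
Lemma exists_between (A B : seq R) :
  (forall a b, a \in A -> b \in B -> a <= b) ->
  exists y, (forall a, a \in A -> a <= y) /\ (forall b, b \in B -> y <= b).
Proof.
elim: A => [|a A IH] AB.
  elim: B {AB} => [|b B [y [_ yB]]]; first by exists 0.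
  exists (Num.min b y); split=> // c; rewrite inE => /orP[/eqP ->|/yB yc].
    by rewrite ge_min lexx.
  by rewrite ge_min yc orbT.
have [|y [yA yB]] := IH; first by move=> c b cA; apply: AB; rewrite inE cA orbT.
exists (Num.max a y); split=> [c|b bB].
  by rewrite inE le_max => /orP[/eqP ->|/yA ->]; rewrite ?lexx ?orbT.
by rewrite ge_max yB // AB // inE eqxx.
Qed.

(** Stated inductively, so that properties of the generators spread by induction; coefficient
    families appear only in [CPA_pair_slope]. *)
Inductive cone {V : lmodType R} (s : seq V) : V -> Prop :=
| cone_gen v : v \in s -> cone s v
| cone_add u v : cone s u -> cone s v -> cone s (u + v)
| cone_scale a v : 0 <= a -> cone s v -> cone s (a *: v).

Lemma cone_sub {V : lmodType R} (s s' : seq V) :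
  (forall v, v \in s' -> cone s v) -> forall v, cone s' v -> cone s v.
Proof.
move=> ss' v; elim=> {v} [v /ss' //|u v _ ? _ ?|a v a0 _ ?]; first exact: cone_add.
exact: cone_scale.
Qed.

(* Fourier-Motzkin elimination of the first functional. *)
Lemma farkas {V : lmodType R} n (phi : 'I_n -> {scalar V}) (tau : {scalar V})
    (s : seq V) :
  (forall v, cone s v -> (forall k, phi k v = 0) -> tau v <= 0) ->
  exists y : 'I_n -> R, forall v, v \in s -> tau v <= \sum_k y k * phi k v.
Proof.
elim: n phi s => [|n IH] phi s H.
  exists (fun=> 0) => v vs; rewrite big_ord0.
  by apply: H; [exact: cone_gen|case].
pose sp := [seq v <- s | 0 < phi ord0 v].
pose sn := [seq v <- s | phi ord0 v < 0].
pose s0 := [seq v <- s | phi ord0 v == 0].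
(* For [p] in [sp] and [q] in [sn] both coefficients are positive, and [phi ord0] cancels on the
   combination. *)
pose comb p q := phi ord0 p *: q + (- phi ord0 q) *: p.
pose s' := s0 ++ [seq comb p q | p <- sp, q <- sn].
have s'P v : v \in s' -> cone s v /\ phi ord0 v = 0.
  rewrite mem_cat => /orP[|/allpairsP[[p q] /= []]].
    by rewrite mem_filter => /andP[/eqP ? ?]; split=> //; exact: cone_gen.
  rewrite !mem_filter => /andP[p0 ps] /andP[q0 qs] ->; split.
    apply: cone_add; apply: cone_scale; try exact: cone_gen.
      exact: ltW.
    by rewrite oppr_ge0 ltW.
  by rewrite linearD !scalarZ /=; ring.
have [v cv v0|y yP] := IH (phi \o lift ord0) s'.
  apply: H; first by apply: cone_sub cv => w /s'P[].
  move=> k; case: (unliftP ord0 k) => [j ->|->]; first exact: v0.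
  elim: cv {v0} => {v} [v /s'P[]//|u v _ u0 _ v0|a v _ _ v0].
    by rewrite linearD /= u0 v0 addr0.
  by rewrite scalarZ v0 mulr0.
(* The missing coefficient [y0] must satisfy [r v <= y0 * phi ord0 v]. Dividing gives lower bounds
   from [sp] and upper bounds from [sn]; they are compatible by the inequality at [comb p q]. *)
pose r v := tau v - \sum_k y k * phi (lift ord0 k) v.
have [a b /mapP[p psp ->] /mapP[q qsn ->]|y0 [y0p y0n]] := exists_between
    [seq r v / phi ord0 v | v <- sp] [seq r v / phi ord0 v | v <- sn].
  move: (psp) (qsn); rewrite !mem_filter => /andP[p0 _] /andP[q0 _].
  have: comb p q \in s'.
    by rewrite mem_cat; apply/orP; right; apply/allpairsP; exists (p, q).
  move=> /yP; rewrite /comb linearD !scalarZ /= => h.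
  have {h} h : phi ord0 p * r q <= phi ord0 q * r p.
    rewrite /r !mulrBr !mulr_sumr lerBlDr -lerBlDl opprB addrC.
    move: h; rewrite [X in _ <= X](_ : _ =
      \sum_i phi ord0 p * (y i * phi (lift ord0 i) q) -
      \sum_i phi ord0 q * (y i * phi (lift ord0 i) p)); first by lra.
    rewrite -sumrB; apply: eq_bigr => i _ /=.
    by rewrite linearD !scalarZ; ring.
  by rewrite ler_pdivrMr // mulrAC ler_ndivlMr // mulrC [X in _ <= X]mulrC.
exists (fun k => if unlift ord0 k is Some j then y j else y0) => v vs.
rewrite big_ord_recl unlift_none; under eq_bigr do rewrite liftK.
suff: r v <= y0 * phi ord0 v by rewrite /r; lra.
have [v0|v0|v0] := ltrgt0P (phi ord0 v).
- by rewrite -ler_pdivrMr //; apply/y0p/map_f; rewrite mem_filter v0.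
- by rewrite -ler_ndivlMr //; apply/y0n/map_f; rewrite mem_filter v0.
rewrite v0 mulr0 subr_le0; apply: yP.
by rewrite mem_cat mem_filter v0 eqxx vs.
Qed.

End Farkas.

(** * Second-order Taylor bound from partial derivatives *)

Section Taylor.
Context {R : realType}.

(** * Directional derivatives from continuous partial derivatives *)

Section Directional.
Context {V : normedModType R}.
Implicit Types (g : V -> R) (v w x : V).

Lemma is_derive_line g v x (t : R) : derivable g (t *: v + x) v ->
  is_derive t 1 (fun s : R => g (s *: v + x)) ('D_v g (t *: v + x)).
Proof.
have E : (fun h : R => h^-1 *: (((fun s : R => g (s *: v + x)) \o shift t) (h *: 1)
      - g (t *: v + x))) =
    (fun h : R => h^-1 *: ((g \o shift (t *: v + x)) (h *: v) - g (t *: v + x))).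
  by apply/funext => h /=; rewrite [h *: 1]mulr1 scalerDl addrA.
by move=> dg; split; rewrite /derivable /derive E.
Qed.

Lemma is_derive_continuous (f : R -> R) (df : R -> R) :
  (forall t : R, is_derive t 1 f (df t)) -> continuous f.
Proof.
by move=> df_ t; apply/differentiable_continuous/derivable1_diffP/ex_derive.
Qed.

(** The step [h] may have either sign, so the intermediate point is located only by its absolute
    value; this suffices for limits. *)
Lemma MVT_line g v x (h : R) : (forall y, derivable g y v) ->
  exists2 c : R, `|c| <= `|h| & g (h *: v + x) - g x = h * 'D_v g (c *: v + x).
Proof.
move=> dg; pose f (s : R) := g (s *: v + x).
have df (t : R) : is_derive t 1 f ('D_v g (t *: v + x)) by exact: is_derive_line.
have f0 : f 0 = g x by rewrite /f scale0r add0r.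
have fc (a b : R) : {within `[a, b], continuous f}.
  exact/continuous_subspaceT/is_derive_continuous.
have [h0|h0] := leP 0 h.
  have [c] := MVT_segment h0 (fun t _ => df t) (fc 0 h).
  rewrite in_itv /= => /andP[c0 ch]; rewrite f0 subr0 mulrC => E.
  by exists c => //; rewrite !ger0_norm.
have [c] := MVT_segment (ltW h0) (fun t _ => df t) (fc h 0).
rewrite in_itv /= => /andP[hc c0]; rewrite f0 sub0r mulrN mulrC => E.
exists c; first by rewrite (ltr0_norm h0) ler0_norm // lerN2.
by rewrite -/(f h) -opprB E opprK.
Qed.

(** This adds one direction at a time. The increment splits into one along [c *: v] from the moved
    base point [h *: w + x], treated by the mean value theorem and continuity of ['D_v g], and one
    along [w] from [x]. *)
Lemma is_derive_addZ g v w (c : R) :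
  (forall y, derivable g y v) -> continuous ('D_v g) ->
  forall x, derivable g x w ->
  is_derive x (c *: v + w) g (c * 'D_v g x + 'D_w g x).
Proof.
move=> dv cv x dw.
pose a (h : R) := h^-1 *: (g (h *: (c *: v + w) + x) - g (h *: w + x)).
pose b (h : R) := h^-1 *: ((g \o shift x) (h *: w) - g x).
have E : (fun h : R => h^-1 *: ((g \o shift x) (h *: (c *: v + w)) - g x)) = a \+ b.
  by apply/funext => h /=; rewrite /a /b -scalerDr /= addrA subrK.
have ca : a @ 0^' --> c * 'D_v g x.
  apply/cvgrPdist_le => e e0.
  have c1 : 0 < `|c| + 1 by rewrite ltr_wpDl.
  have /cvgrPdist_le /(_ (e / (`|c| + 1)) (divr_gt0 e0 c1)) := cv x.
  move=> /nbhs_normP[d /= d0 xd].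
  (* The intermediate point is within [|h| * M] of [x]; the summand 1 makes [M] positive. *)
  pose M := `|c| * `|v| + `|w| + 1.
  have M0 : 0 < M by rewrite ltr_wpDl // addr_ge0 // mulr_ge0.
  near=> h.
  have h0 : h != 0 by near: h; exact: nbhs_dnbhs_neq.
  have hd : `|h| < d / M by near: h; apply: dnbhs0_lt; exact: divr_gt0.
  have [xi xih] := @MVT_line g v (h *: w + x) (h * c) dv.
  rewrite addrA -scalerA -scalerDr => Ea.
  rewrite /a Ea -mulrA [_ *: _]mulrA mulVf // mul1r -mulrBr normrM.
  have /xd /= : ball_ Num.norm x d (xi *: v + (h *: w + x)).
    rewrite /ball_ /= distrC addrA addrK.
    apply: le_lt_trans (_ : `|h| * M < d); last by rewrite -ltr_pdivlMr.
    rewrite (le_trans (ler_normD _ _)) // !normrZ /M !mulrDr mulr1 mulrA.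
    rewrite -[leLHS]addr0; apply: lerD => //; apply: lerD => //.
    by rewrite -normrM ler_wpM2r.
  move=> /(ler_wpM2l (normr_ge0 c)) /le_trans; apply.
  rewrite mulrCA ger_pMr // ler_pdivrMr // mul1r lerDl //.
have cb : b @ 0^' --> 'D_w g x by [].
have cab : a \+ b @ 0^' --> c * 'D_v g x + 'D_w g x by exact: cvgD.
split; first by rewrite /derivable E; apply: cvgP cab.
by rewrite /derive E; exact: cvg_lim cab.
Unshelve. all: by end_near. Qed.

End Directional.

Lemma is_derive_partial n (g : 'rV[R]_n -> R) :
  (forall q y, derivable g y (ebasis q)) -> (forall q, continuous (partial g q)) ->
  forall w x, is_derive x w g (\sum_q w 0 q * partial g q x).
Proof.
move=> dg cg w x.
have -> : w = \sum_q w 0 q *: ebasis q.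
  rewrite [LHS]row_sum_delta; apply: eq_bigr => q _; congr (_ *: _).
  by apply/rowP => k; rewrite !mxE eqxx.
have -> : \sum_q (\sum_q0 w 0 q0 *: ebasis q0 : 'rV[R]_n) 0 q * partial g q x =
    \sum_q w 0 q * partial g q x.
  apply: eq_bigr => q _; congr (_ * _); rewrite summxE (bigD1 q) //= big1 => [|k kq].
    by rewrite !mxE eqxx mulr1 addr0.
  by rewrite !mxE eq_sym (negbTE kq) mulr0.
elim: (index_enum _) => [|q r IH]; last first.
  (* The tail sum is folded back into the derivative along the remaining directions, the form that
     [is_derive_addZ] yields. *)
  rewrite !big_cons -[X in is_derive _ _ _ (_ + X)](@derive_val _ _ _ _ _ _ _ IH).
  by apply: is_derive_addZ; [exact: dg|exact: cg|exact: ex_derive].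
rewrite !big_nil.
have E : (fun h : R => h^-1 *: ((g \o shift x) (h *: (0 : 'rV_n)) - g x)) = cst 0.
  by apply/funext => h /=; rewrite scaler0 add0r subrr scaler0.
by split; rewrite /derivable /derive E; [exact: is_cvg_cst|exact: lim_cst].
Qed.

Lemma taylor2_le (f f' f'' : R -> R) (M : R) :
  (forall t : R, is_derive t 1 f (f' t)) ->
  (forall t : R, is_derive t 1 f' (f'' t)) ->
  (forall t, 0 <= t <= 1 -> f'' t <= M) ->
  f 1 - f 0 - f' 0 <= M / 2.
Proof.
move=> df df' f''M.
have f'M t : 0 <= t <= 1 -> f' t - f' 0 <= M * t.
  move=> /andP[t0 t1].
  have [|c] := MVT_segment t0 (fun x _ => df' x).
    exact/continuous_subspaceT/is_derive_continuous.
  rewrite in_itv /= subr0 => /andP[c0 ct] ->.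
  by apply: ler_wpM2r => //; apply: f''M; rewrite c0 (le_trans ct).
(* Subtracting the quadratic majorant leaves a function whose derivative is nonpositive on [0, 1] by
   [f'M], so [h 1 <= h 0]. *)
pose h t := f t - (f' 0 * t + M / 2 * t ^+ 2).
have dh (t : R) : is_derive t 1 h (f' t - (f' 0 + M * t)).
  pose p : {poly R} := f' 0 *: 'X + (M / 2) *: 'X^2.
  have -> : h = f - horner p.
    by apply/funext => s; rewrite /h [RHS]/(f s - p.[s]) /p !hornerE.
  apply: is_deriveB.
  rewrite (_ : f' 0 + M * t = p^`().[t]); first exact: is_derive_poly.
  by rewrite /p derivD !derivZ derivX derivXn !hornerE; field.
have [|c] := MVT_segment (ler01 : (0 : R) <= 1) (fun x _ => dh x).
  exact/continuous_subspaceT/is_derive_continuous.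
rewrite in_itv /= => /f'M c01.
by rewrite /h subr0 mulr1 expr1n expr0n !mulr0 !mulr1 addr0 subr0; lra.
Qed.

Lemma taylor2_norm (f f' f'' : R -> R) (M : R) :
  (forall t : R, is_derive t 1 f (f' t)) ->
  (forall t : R, is_derive t 1 f' (f'' t)) ->
  (forall t, 0 <= t <= 1 -> `|f'' t| <= M) ->
  `|f 1 - f 0 - f' 0| <= M / 2.
Proof.
move=> df df' f''M.
have h1 : f 1 - f 0 - f' 0 <= M / 2.
  by apply: taylor2_le df df' _ => t /f''M; exact: le_trans (ler_norm _).
have h2 : (- f) 1 - (- f) 0 - (- f') 0 <= M / 2.
  apply: (@taylor2_le (- f) (- f') (- f'')) => t /f''M; apply: le_trans.
  by rewrite -normrN ler_norm.
move: h1 h2; rewrite !fctE ler_norml; lra.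
Qed.

(** One-variable Taylor along the segment from [x] to [w + x]; an entrywise Hessian bound turns the
    quadratic form into a squared 1-norm. *)
Lemma C2_taylor n (g : 'rV[R]_n -> R) (x w : 'rV[R]_n) (beta : R) :
  C2 g ->
  (forall t q r, 0 <= t <= 1 -> `|partial (partial g q) r (t *: w + x)| <= beta) ->
  `|g (w + x) - g x - \sum_q w 0 q * partial g q x| <=
    beta * (\sum_q `|w 0 q|) ^+ 2 / 2.
Proof.
move=> g2 gb.
have dg : forall w x, is_derive x w g (\sum_q w 0 q * partial g q x).
  by apply: is_derive_partial => q; have [] := g2 q q.
have dpg q : forall w x, is_derive x w (partial g q)
    (\sum_r w 0 r * partial (partial g q) r x).
  by apply: is_derive_partial => r; have [] := g2 q r.
pose f (t : R) := g (t *: w + x).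
pose f' (t : R) := \sum_q w 0 q * partial g q (t *: w + x).
pose f'' (t : R) :=
  \sum_q w 0 q * \sum_r w 0 r * partial (partial g q) r (t *: w + x).
have := @taylor2_norm f f' f'' (beta * (\sum_q `|w 0 q|) ^+ 2).
rewrite /f /f' scale1r scale0r add0r; apply.
- move=> t; rewrite -(@derive_val _ _ _ _ _ _ _ (dg w (t *: w + x))).
  exact/is_derive_line/ex_derive.
- move=> t.
  have -> : (fun s : R => \sum_q w 0 q * partial g q (s *: w + x)) =
      \sum_q (fun s : R => w 0 q *: partial g q (s *: w + x)).
    by apply/funext => s; rewrite fct_sumE.
  apply: is_derive_sum => q; apply: is_deriveZ.
  rewrite -(@derive_val _ _ _ _ _ _ _ (dpg q w (t *: w + x))).
  exact/is_derive_line/ex_derive.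
- move=> t t01; rewrite /f'' expr2 mulrCA mulr_suml.
  apply: le_trans (ler_norm_sum _ _ _) _; apply: ler_sum => q _.
  rewrite normrM ler_wpM2l // mulr_sumr.
  apply: le_trans (ler_norm_sum _ _ _) _; apply: ler_sum => r _.
  by rewrite normrM mulrC ler_wpM2r // gb.
Qed.

End Taylor.

(** * Interpolation on a simplex *)

Section Interpolation.
Context {R : realType}.

(** Weighted Cauchy-Schwarz by Lagrange's identity: twice the gap is the double sum of
    [c i * c j * (a i - a j) ^+ 2]. *)
Lemma sqr_sum_le {I : finType} (c a : I -> R) : (forall i, 0 <= c i) ->
  (\sum_i c i * a i) ^+ 2 <= (\sum_i c i) * \sum_i c i * a i ^+ 2.
Proof.
move=> c0; rewrite -(@ler_pM2l _ 2) // -subr_ge0.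
have -> : 2 * ((\sum_i c i) * \sum_i c i * a i ^+ 2) - 2 * (\sum_i c i * a i) ^+ 2 =
    \sum_i \sum_j c i * c j * (a i - a j) ^+ 2.
  under [RHS]eq_bigr => i _.
    rewrite (_ : \sum_j _ = c i * (\sum_j c j * a j ^+ 2) +
      (c i * a i ^+ 2) * (\sum_j c j) - 2 * ((c i * a i) * \sum_j c j * a j)).
      over.
    rewrite !mulr_sumr -big_split -sumrB; apply: eq_bigr => j _ /=; ring.
  by rewrite sumrB big_split -mulr_sumr -!mulr_suml /=; ring.
by apply: sumr_ge0 => i _; apply: sumr_ge0 => j _; rewrite mulr_ge0 ?sqr_ge0 ?mulr_ge0.
Qed.

Lemma norm2_ge0 {n} (w : 'rV[R]_n) : 0 <= norm2 w.
Proof. exact: sqrtr_ge0. Qed.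

Lemma norm2_sub_sym {n} (y z : 'rV[R]_n) : norm2 (y - z) = norm2 (z - y).
Proof.
rewrite /norm2; congr Num.sqrt; apply: eq_bigr => k _.
by rewrite !mxE -sqrrN opprB.
Qed.

Lemma sqr_norm2 {n} (w : 'rV[R]_n) : norm2 w ^+ 2 = \sum_q w 0 q ^+ 2.
Proof. by rewrite sqr_sqrtr // sumr_ge0 // => q _; exact: sqr_ge0. Qed.

Lemma coord_le_norm2 {n} (w : 'rV[R]_n) q : `|w 0 q| <= norm2 w.
Proof.
rewrite -(ler_pXn2r (isT : (0 < 2)%N)) ?nnegrE ?norm2_ge0 // sqr_norm2.
rewrite real_normK ?num_real // (bigD1 q) //= lerDl.
by apply: sumr_ge0 => k _; exact: sqr_ge0.
Qed.

(** Cauchy-Schwarz with unit weights; this is the source of the factor [n] in [cij]. *)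
Lemma sum_norm_le_norm2 {n} (w : 'rV[R]_n) :
  (\sum_q `|w 0 q|) ^+ 2 <= n%:R * norm2 w ^+ 2.
Proof.
have := @sqr_sum_le _ (fun=> 1) (fun q => `|w 0 q|) (fun=> ler01).
rewrite sumr_const card_ord sqr_norm2.
under eq_bigr do rewrite mul1r.
by under [X in _ * X]eq_bigr do rewrite mul1r real_normK ?num_real //.
Qed.

Lemma sqr_norm2_convex {n k} (lam : 'I_k -> R) (w : 'I_k -> 'rV[R]_n) :
  (forall j, 0 <= lam j) -> \sum_j lam j = 1 ->
  norm2 (\sum_j lam j *: w j) ^+ 2 <= \sum_j lam j * norm2 (w j) ^+ 2.
Proof.
move=> lam0 lam1; rewrite sqr_norm2.
under [leRHS]eq_bigr do rewrite sqr_norm2 mulr_sumr.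
rewrite exchange_big; apply: ler_sum => q _ /=.
rewrite summxE; under [X in X ^+ 2 <= _]eq_bigr do rewrite mxE.
by apply: le_trans (sqr_sum_le _ _ lam0) _; rewrite lam1 mul1r.
Qed.

(** * One simplex: barycentric coordinates, half-spaces, affine interpolation *)

Section Simplex.
Context {n mT : nat} (x : 'I_mT -> 'I_n.+1 -> 'rV[R]_n) (i : 'I_mT).

Lemma simplexP (y : 'rV[R]_n) : simplex x i y <->
  exists lam : 'I_n.+1 -> R,
    [/\ forall j, 0 <= lam j, \sum_j lam j = 1 & y = \sum_j lam j *: x i j].
Proof.
by split=> [[lam [? _ ? ?]]|[lam [? ? ?]]]; exists lam; split=> // j; rewrite inE.
Qed.

Lemma simplex_vertex j : simplex x i (x i j).
Proof.
apply/simplexP; exists (fun k => (k == j)%:R); split.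
- by move=> k; rewrite ler0n.
- by rewrite (bigD1 j) //= eqxx big1 ?addr0 // => k /negbTE ->.
- rewrite (bigD1 j) //= eqxx scale1r big1 ?addr0 // => k /negbTE ->.
  by rewrite scale0r.
Qed.

Lemma simplex_segment y z (t : R) : simplex x i y -> simplex x i z -> 0 <= t <= 1 ->
  simplex x i (t *: (z - y) + y).
Proof.
move=> /simplexP[lam [lam0 lam1 ->]] /simplexP[mu [mu0 mu1 ->]] /andP[t0 t1].
apply/simplexP; exists (fun j => t * mu j + (1 - t) * lam j); split.
- by move=> j; rewrite addr_ge0 // mulr_ge0 // subr_ge0.
- by rewrite big_split -!mulr_sumr lam1 mu1 /=; ring.
rewrite -sumrB scaler_sumr -big_split; apply: eq_bigr => j _ /=.
by apply/rowP => k; rewrite !mxE; ring.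
Qed.

Lemma sub_convex_comb (lam : 'I_n.+1 -> R) j0 : \sum_j lam j = 1 ->
  \sum_j lam j *: x i j - x i j0 = \sum_j lam j *: (x i j - x i j0).
Proof.
move=> lam1; under [RHS]eq_bigr do rewrite scalerBr.
by rewrite sumrB -scaler_suml lam1 scale1r.
Qed.

(* Both Taylor remainders at x_{i,0}, of the point and of the vertices, are
   quadratic; the first-order terms cancel by barycentricity. *)
Lemma interpolation_error (g : 'rV[R]_n -> R) (beta : R) (lam : 'I_n.+1 -> R) :
  C2 g -> 0 <= beta ->
  (forall q r xi, simplex x i xi -> `|partial (partial g q) r xi| <= beta) ->
  (forall j, 0 <= lam j) -> \sum_j lam j = 1 ->
  `|g (\sum_j lam j *: x i j) - \sum_j lam j * g (x i j)|
    <= beta * \sum_j lam j * cij x i j.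
Proof.
move=> g2 beta0 gb lam0 lam1.
set y := \sum_j lam j *: x i j; set x0 := x i ord0.
have Sy : simplex x i y by apply/simplexP; exists lam.
pose e z := g z - g x0 - \sum_q (z - x0) 0 q * partial g q x0.
have eb z : simplex x i z -> `|e z| <= beta * n%:R / 2 * norm2 (z - x0) ^+ 2.
  move=> Sz; have := @C2_taylor _ _ g x0 (z - x0) beta g2.
  rewrite subrK => /(_ _)/le_trans; apply.
    by move=> t q r t01; apply: gb; apply: simplex_segment => //; exact: simplex_vertex.
  have := ler_wpM2l beta0 (sum_norm_le_norm2 (z - x0)); lra.
have yE : y - x0 = \sum_j lam j *: (x i j - x0) by exact: sub_convex_comb.
have -> : g y - \sum_j lam j * g (x i j) = e y - \sum_j lam j * e (x i j).
  under [X in _ = _ - X]eq_bigr => j _.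
    rewrite (_ : _ * _ = lam j * g (x i j) - lam j * g x0 -
      \sum_q lam j * (x i j - x0) 0 q * partial g q x0).
      over.
    by rewrite /e !mulrBr mulr_sumr; under [in RHS]eq_bigr do rewrite -mulrA.
  rewrite !sumrB -mulr_suml lam1 mul1r exchange_big /=.
  under [X in _ = _ - (_ - X)]eq_bigr do rewrite -mulr_suml.
  rewrite /e yE; under [X in _ = _ - X - _]eq_bigr do rewrite summxE.
  under [X in _ = _ - X - _]eq_bigr => q _.
    under eq_bigr do rewrite mxE.
    over.
  ring.
set M := \big[Num.max/0]_(k < n) norm2 (x i (lift ord0 k) - x i ord0).
have M0 : 0 <= M by exact: bigmax_ge_id.
have xM j : norm2 (x i j - x0) <= M.
  case: (unliftP ord0 j) => [k ->|->]; first exact: le_bigmax.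
  by rewrite subrr /norm2 big1 ?sqrtr0 // => q _; rewrite mxE expr0n.
pose K := beta * n%:R / 2.
have K0 : 0 <= K by rewrite /K !mulr_ge0 // ?invr_ge0.
(* Only one factor of the squared norm is relaxed to [M]. This gives the mixed term of [cij]; the
   remainders at the vertices give its squared term. *)
have ey : `|e y| <= \sum_j lam j * (K * (norm2 (x i j - x0) * M)).
  apply: le_trans (eb _ Sy) _; rewrite -/K yE.
  apply: le_trans (ler_wpM2l K0 (sqr_norm2_convex _ _ lam0 lam1)) _.
  rewrite mulr_sumr; apply: ler_sum => j _; rewrite mulrCA.
  by rewrite !ler_wpM2l ?norm2_ge0 ?xM.
have ev : `|\sum_j lam j * e (x i j)| <=
    \sum_j lam j * (K * norm2 (x i j - x0) ^+ 2).
  apply: le_trans (ler_norm_sum _ _ _) _; apply: ler_sum => j _.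
  by rewrite normrM ger0_norm // ler_wpM2l // eb //; exact: simplex_vertex.
apply: le_trans (ler_normB _ _) _; apply: le_trans (lerD ey ev) _.
rewrite -big_split mulr_sumr le_eqVlt; apply/orP; left; apply/eqP.
by apply: eq_bigr => j _ /=; rewrite /cij -/M /K -/x0; ring.
Qed.

Hypothesis Xu : Xmat x i \in unitmx.

(** The inverse edge matrix applied to [y - x i ord0] gives the barycentric coordinates of nonzero
    index, and one minus their sum gives that of index 0. All are affine in [y]. *)
Lemma simplex_halfspaces : exists (b : 'I_n.+1 -> R) (c : 'I_n.+1 -> 'cV[R]_n),
  forall y, simplex x i y <-> forall j, 0 <= b j + (y *m c j) 0 0.
Proof.
pose N := invmx (Xmat x i); pose x0 := x i ord0.
pose b' (j : 'I_n) := - (x0 *m col j N) 0 0.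
exists (fun j => if unlift ord0 j is Some k then b' k else 1 - \sum_k b' k).
exists (fun j => if unlift ord0 j is Some k then col k N else - \sum_k col k N).
move=> y.
have colE (z : 'rV[R]_n) k : (z *m col k N) 0 0 = (z *m N) 0 k.
  by rewrite !mxE; apply: eq_bigr => q _; rewrite mxE.
have cE (k : 'I_n) : b' k + (y *m col k N) 0 0 = ((y - x0) *m N) 0 k.
  by rewrite /b' !colE mulmxBl addrC [RHS]mxE; congr (_ + _); rewrite [RHS]mxE.
have c0E : 1 - \sum_k b' k + (y *m - \sum_k col k N) 0 0 =
    1 - \sum_k ((y - x0) *m N) 0 k.
  rewrite mulmxN mulmx_sumr mxE summxE -addrA -opprD -big_split /=.
  by under eq_bigr do rewrite cE.
have rowX (lam : 'I_n -> R) :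
    \sum_k lam k *: (x i (lift ord0 k) - x0) = (\row_k lam k) *m Xmat x i.
  apply/rowP => q; rewrite !mxE summxE; apply: eq_bigr => k _.
  by rewrite !mxE.
split=> [/simplexP[lam [lam0 lam1 yE]] j|H].
  have NE : (y - x0) *m N = \row_k lam (lift ord0 k).
    rewrite yE sub_convex_comb // big_ord_recl subrr scaler0 add0r rowX.
    by rewrite mulmxK.
  case: (unliftP ord0 j) => [k|] _.
    by rewrite cE NE mxE.
  rewrite c0E NE; under eq_bigr do rewrite mxE.
  by move: lam1; rewrite big_ord_recl => <-; rewrite addrK.
pose lam (j : 'I_n.+1) := if unlift ord0 j is Some k then ((y - x0) *m N) 0 k
  else 1 - \sum_k ((y - x0) *m N) 0 k.
have lamk k : lam (lift ord0 k) = ((y - x0) *m N) 0 k by rewrite /lam liftK.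
have lam1 : \sum_j lam j = 1.
  rewrite big_ord_recl; under eq_bigr do rewrite lamk.
  by rewrite /lam unlift_none subrK.
apply/simplexP; exists lam; split=> //.
  move=> j; have := H j; rewrite /lam.
  by case: unliftP => [k|] _; rewrite ?cE ?c0E.
apply: (addIr (- x0)); rewrite sub_convex_comb // big_ord_recl subrr scaler0 add0r.
rewrite rowX; under eq_mx do rewrite lamk.
have -> : \row_j ((y - x0) *m N) 0 j = (y - x0) *m N by apply/rowP => k; rewrite mxE.
by rewrite mulmxKV.
Qed.

(** A half-space inequality that fails strictly at [y] still fails after a short step. *)
Lemma simplex_line_near y v : ~ simplex x i y ->
  \forall h \near 0^'+, ~ simplex x i (y + h *: v).
Proof.
have [b [c bc]] := simplex_halfspaces.
move=> /bc/existsNP[j /negP]; rewrite -ltNge => yj.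
pose d := (v *m c j) 0 0.
have d1 : 0 < `|d| + 1 by rewrite ltr_wpDl.
near=> h => /bc/(_ j).
have h0 : 0 < h by near: h; exact: nbhs_right_gt.
(* The violation divided by a bound on the slope; adding 1 keeps the divisor positive. *)
have : h < - (b j + (y *m c j) 0 0) / (`|d| + 1).
  by near: h; apply: nbhs_right_lt; rewrite divr_gt0 // oppr_gt0.
have -> : ((y + h *: v) *m c j) 0 0 = (y *m c j) 0 0 + h * d.
  by rewrite mulmxDl -scalemxAl mxE [X in _ + X]mxE.
rewrite ltr_pdivlMr //.
have := ler_norm d; nra.
Unshelve. all: by end_near. Qed.

Lemma gradW_edge (Wv : 'rV[R]_n -> R) j :
  ((x i j - x i ord0) *m gradW x Wv i) 0 0 = Wv (x i j) - Wv (x i ord0).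
Proof.
case: (unliftP ord0 j) => [k|] ->; last by rewrite !subrr mul0mx mxE.
have -> : x i (lift ord0 k) - x i ord0 = row k (Xmat x i).
  by apply/rowP => q; rewrite !mxE.
by rewrite -row_mul /gradW mulKVmx // !mxE.
Qed.

Context {Wv W : 'rV[R]_n -> R} (WCPA : is_CPA x Wv W).

Lemma CPA_grad y : simplex x i y ->
  W y = Wv (x i ord0) + ((y - x i ord0) *m gradW x Wv i) 0 0.
Proof.
move=> /WCPA ->; congr (_ + _); rewrite mxE.
by apply: eq_bigr => k _; rewrite !mxE mulrC.
Qed.

Lemma CPA_convex_comb (lam : 'I_n.+1 -> R) :
  (forall j, 0 <= lam j) -> \sum_j lam j = 1 ->
  W (\sum_j lam j *: x i j) = \sum_j lam j * Wv (x i j).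
Proof.
move=> lam0 lam1; rewrite CPA_grad; last by apply/simplexP; exists lam.
rewrite sub_convex_comb // mulmx_suml summxE.
under eq_bigr do rewrite -scalemxAl mxE gradW_edge mulrBr.
by rewrite sumrB -mulr_suml lam1 mul1r addrC subrK.
Qed.

End Simplex.
End Interpolation.

(** * Lipschitz continuity and the barrier inequality *)

Section Lipschitz.
Context {R : realType} {n : nat}.

(** Differences of points are paired with differences of [W]. [farkas] then bounds the second
    component by a combination of the coordinates of the first; [R^o] views the scalars as a module
    over themselves. *)
Definition coord_fst (k : 'I_n) (v : 'rV[R]_n * R^o) : R := v.1 0 k.

Lemma coord_fst_scalar k : scalar (coord_fst k).
Proof. by move=> a u v; rewrite /coord_fst !mxE. Qed.

HB.instance Definition _ k :=
  GRing.isLinear.Build R ('rV[R]_n * R^o)%type R *%R (coord_fst k)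
    (coord_fst_scalar k).

Definition value_snd (v : 'rV[R]_n * R^o) : R := v.2.

Lemma value_snd_scalar : scalar value_snd.
Proof. by []. Qed.

HB.instance Definition _ :=
  GRing.isLinear.Build R ('rV[R]_n * R^o)%type R *%R value_snd value_snd_scalar.

Context {mT : nat} (x : 'I_mT -> 'I_n.+1 -> 'rV[R]_n).
Hypothesis Xu : forall i, Xmat x i \in unitmx.
Context {Wv W : 'rV[R]_n -> R} (WCPA : is_CPA x Wv W).

(* Farkas' lemma applied to the vertex differences of the two simplexes. Its
   hypothesis only says that W is single-valued where they meet, so no
   compactness or face-to-face argument is needed. *)
Lemma CPA_pair_slope i i' : exists eta : 'I_n -> R,
  forall y z, simplex x i y -> simplex x i' z ->
    W y - W z <= \sum_k eta k * (y - z) 0 k.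
Proof.
pose gen j j' : 'rV[R]_n * R^o := (x i j - x i' j', Wv (x i j) - Wv (x i' j')).
pose s := [seq gen j j' | j <- enum 'I_n.+1, j' <- enum 'I_n.+1].
(* Each generator takes one vertex from either simplex, so the weights [a] and [b] always have equal
   total mass. *)
have cs v : cone s v -> exists a b : 'I_n.+1 -> R,
    [/\ forall j, 0 <= a j, forall j, 0 <= b j, \sum_j a j = \sum_j b j,
      v.1 = \sum_j a j *: x i j - \sum_j b j *: x i' j &
      v.2 = \sum_j a j * Wv (x i j) - \sum_j b j * Wv (x i' j)].
  elim=> {v} [v /allpairsP[[j j'] /= [_ _ ->]]|u v _ [a [b [a0 b0 ab ua ub]]] _
      [a' [b' [a0' b0' ab' va vb]]]|t v t0 _ [a [b [a0 b0 ab va vb]]]].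
  - have sumd (V : lmodType R) (F : 'I_n.+1 -> V) j1 :
        \sum_k (k == j1)%:R *: F k = F j1.
      rewrite (bigD1 j1) //= eqxx scale1r big1 ?addr0 // => k /negbTE ->.
      by rewrite scale0r.
    have sum1 (j1 : 'I_n.+1) : \sum_k (k == j1)%:R = 1 :> R.
      by rewrite (bigD1 j1) //= eqxx big1 ?addr0 // => k /negbTE ->.
    exists (fun k => (k == j)%:R), (fun k => (k == j')%:R); split=> //=.
    + by rewrite !sum1.
    + by rewrite !sumd.
    + by rewrite (sumd R^o (fun k => Wv (x i k))) (sumd R^o (fun k => Wv (x i' k))).
  - exists (fun j => a j + a' j), (fun j => b j + b' j); split=> [j|j|||].
    + by rewrite addr_ge0.
    + by rewrite addr_ge0.
    + by rewrite !big_split /= ab ab'.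
    + rewrite /= ua va; under [X in _ = X - _]eq_bigr do rewrite scalerDl.
      under [X in _ = _ - X]eq_bigr do rewrite scalerDl.
      by rewrite !big_split /= opprD addrACA.
    + rewrite /= ub vb; under [X in _ = X - _]eq_bigr do rewrite mulrDl.
      under [X in _ = _ - X]eq_bigr do rewrite mulrDl.
      by rewrite !big_split /= opprD addrACA.
  - exists (fun j => t * a j), (fun j => t * b j); split=> [j|j|||].
    + by rewrite mulr_ge0.
    + by rewrite mulr_ge0.
    + by rewrite -!mulr_sumr ab.
    + rewrite /= va scalerBr !scaler_sumr.
      under [X in _ = X - _]eq_bigr do rewrite -scalerA.
      by under [X in _ = _ - X]eq_bigr do rewrite -scalerA.
    + rewrite /= vb [LHS]mulrBr !mulr_sumr.
      under [X in _ = X - _]eq_bigr do rewrite -mulrA.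
      by under [X in _ = _ - X]eq_bigr do rewrite -mulrA.
have [v /cs[a [b [a0 b0 ab va vb]]] v0|eta etaP] :=
    @farkas R ('rV[R]_n * R^o)%type n coord_fst value_snd s.
  have {va}E : \sum_j a j *: x i j = \sum_j b j *: x i' j.
    apply/eqP; rewrite -subr_eq0 -va; apply/eqP/rowP => k.
    by rewrite mxE; exact: v0.
  rewrite /= /value_snd vb {v vb v0}.
  (* Zero mass makes all weights vanish. Otherwise dividing by the mass gives two convex
     combinations of the same point, where [W] has a single value. *)
  have [S0|S0] := eqVneq (\sum_j a j) 0.
    rewrite big1 => [|j _]; last first.
      by rewrite (psumr_eq0P (fun k _ => a0 k) S0) ?mul0r.
    rewrite big1 ?subr0 // => j _.
    by rewrite ab in S0; rewrite (psumr_eq0P (fun k _ => b0 k) S0) ?mul0r.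
  have Sp : 0 < \sum_j a j by rewrite lt0r S0 sumr_ge0.
  have norml (c : 'I_n.+1 -> R) i1 : (forall j, 0 <= c j) -> \sum_j c j = \sum_j a j ->
      \sum_j c j * Wv (x i1 j) =
      (\sum_j a j) * W ((\sum_j a j)^-1 *: \sum_j c j *: x i1 j).
    move=> c0 ca; rewrite scaler_sumr; under [X in W X]eq_bigr do rewrite scalerA.
    rewrite (CPA_convex_comb _ _ (Xu i1) WCPA).
    - rewrite mulr_sumr; apply: eq_bigr => j _.
      by rewrite !mulrA divff // mul1r.
    - by move=> j; rewrite mulr_ge0 // invr_ge0 ltW.
    - by rewrite -mulr_sumr ca mulVf.
  by rewrite (norml a i) // (norml b i') // E subrr.
exists eta => y z /simplexP[lam [lam0 lam1 ->]] /simplexP[mu [mu0 mu1 ->]].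
rewrite !(CPA_convex_comb _ _ (Xu _) WCPA) //.
pose F (w : 'rV[R]_n) := \sum_k eta k * w 0 k.
have FB u w : F (u - w) = F u - F w.
  by rewrite /F -sumrB; apply: eq_bigr => k _; rewrite !mxE mulrBr.
have FZ (c : 'I_n.+1 -> R) i1 : F (\sum_j c j *: x i1 j) = \sum_j c j * F (x i1 j).
  rewrite /F; under [RHS]eq_bigr do rewrite mulr_sumr.
  rewrite exchange_big; apply: eq_bigr => k _ /=.
  rewrite summxE mulr_sumr; apply: eq_bigr => j _.
  by rewrite mxE mulrCA.
have vtx j j' : Wv (x i j) - F (x i j) <= Wv (x i' j') - F (x i' j').
  have : gen j j' \in s.
    by apply/allpairsP; exists (j, j'); rewrite /= !mem_enum.
  by move=> /etaP; rewrite -/(F (gen j j').1) /value_snd /= FB; lra.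
rewrite -/(F _) FB !FZ.
(* The vertex inequalities [vtx] are averaged over both sets of weights, each of total mass 1. *)
suff : \sum_j lam j * (Wv (x i j) - F (x i j)) <=
    \sum_j mu j * (Wv (x i' j) - F (x i' j)).
  under [leLHS]eq_bigr do rewrite mulrBr.
  under [leRHS]eq_bigr do rewrite mulrBr.
  by rewrite !sumrB; lra.
rewrite -[leRHS]mul1r -[X in X * _]lam1 mulr_suml; apply: ler_sum => j _.
apply: ler_wpM2l => //.
rewrite -[leLHS]mul1r -[X in X * _]mu1 mulr_suml; apply: ler_sum => j' _.
exact: ler_wpM2l.
Qed.

Lemma CPA_lipschitz : exists L : R, forall i i' y z,
  simplex x i y -> simplex x i' z -> `|W y - W z| <= L * norm2 (y - z).
Proof.
have /choice[eta etaP] (ii : 'I_mT * 'I_mT) : exists eta : 'I_n -> R,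
    forall y z, simplex x ii.1 y -> simplex x ii.2 z ->
    W y - W z <= \sum_k eta k * (y - z) 0 k.
  exact: CPA_pair_slope.
(* There are finitely many pairs of simplexes, so one sum dominates every slope. *)
pose L := \sum_ii \sum_k `|eta ii k|.
have LP i i' y z : simplex x i y -> simplex x i' z ->
    W y - W z <= L * norm2 (y - z).
  move=> Sy Sz; apply: le_trans (etaP (i, i') y z Sy Sz) _.
  apply: (@le_trans _ _ ((\sum_k `|eta (i, i') k|) * norm2 (y - z))).
    rewrite mulr_suml; apply: ler_sum => k _.
    apply: le_trans (ler_norm _) _; rewrite normrM ler_wpM2l //.
    exact: coord_le_norm2.
  rewrite ler_wpM2r ?norm2_ge0 // /L (bigD1 (i, i')) //= lerDl.
  by apply: sumr_ge0 => ii _; apply: sumr_ge0.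
exists L => i i' y z Sy Sz; rewrite ler_norml lerNl opprB.
by rewrite {1}norm2_sub_sym (LP _ _ _ _ Sz Sy) (LP _ _ _ _ Sy Sz).
Qed.

End Lipschitz.

(** * Norm bounds for the input term *)

Lemma norminf_coord {R : realType} {m} (u : 'rV[R]_m) (c : R) :
  norminf u <= c -> forall k, `|u 0 k| <= c.
Proof. by move=> uc k; apply: le_trans uc; exact: le_bigmax. Qed.

Lemma mxnorminf_row {R : realType} {n m} (A : 'M[R]_(n, m)) (c : R) :
  mxnorminf A <= c -> forall p, \sum_k `|A p k| <= c.
Proof.
move=> Ac p; apply: le_trans Ac.
exact: (@le_bigmax _ _ _ 0 (fun p => \sum_k `|A p k|)).
Qed.

Lemma Gu_le {R : realType} {n m} (A : 'M[R]_(n, m)) (u : 'rV[R]_m) (a c : R) :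
  mxnorminf A <= a -> norminf u <= c -> 0 <= c ->
  forall p, `|Gu A u 0 p| <= a * c.
Proof.
move=> /mxnorminf_row Aa /norminf_coord uc c0 p; rewrite mxE.
apply: le_trans (ler_norm_sum _ _ _) _.
apply: le_trans (ler_wpM2r c0 (Aa p)).
by rewrite mulr_suml; apply: ler_sum => k _; rewrite normrM ler_wpM2l.
Qed.

(** * Positivity and the barrier inequality *)

Section Barrier.
Context {R : realType} {n m mT : nat} {f : 'rV[R]_n -> 'rV[R]_n}
  {G : 'rV[R]_n -> 'M[R]_(n, m)} {x : 'I_mT -> 'I_n.+1 -> 'rV[R]_n}
  {beta ghat : 'I_mT -> R}.
Hypothesis fC2 : forall i (p : 'I_n), C2_on (simplex x i) (fun y => f y 0 p).
Hypothesis fbeta : forall i (p q r : 'I_n) (g : 'rV[R]_n -> R),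
  C2 g -> (forall y, simplex x i y -> g y = f y 0 p) ->
  forall xi, simplex x i xi -> `|partial (partial g q) r xi| <= beta i.
Hypothesis Gghat : forall i y, simplex x i y -> mxnorminf (G y) <= ghat i.
Context {A1 : set 'rV[R]_n} {Wv : 'rV[R]_n -> R} {l : 'I_mT -> 'rV[R]_n} {b2 uhat : R}.
Hypothesis bc : barrier_conditions x f beta ghat A1 Wv l b2 uhat.

(** In each coordinate, the interpolation error of [f] and the input term are multiplied by a
    gradient entry of size at most [l]. Summing gives the average of the [Dij] with the barycentric
    weights of [y]. *)
Lemma grad_flow_le i y u : ~ (simplex x i `<=` A1) -> simplex x i y ->
  norminf u <= uhat -> ((f y + Gu (G y) u) *m gradW x Wv i) 0 0 <= - b2.
Proof.
have [uhat0 _ gl Db2] := bc.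
move=> /Db2 iD Sy uu; have /simplexP[lam [lam0 lam1 yE]] := Sy.
pose C := \sum_j lam j * cij x i j.
have fp p : `|f y 0 p - \sum_j lam j * f (x i j) 0 p| <= beta i * C.
  have [g [g2 gf]] := fC2 i p.
  have gb q r xi : simplex x i xi -> `|partial (partial g q) r xi| <= beta i.
    exact: (fbeta i p q r g g2 gf).
  (* [beta i] bounds an absolute value at the point [y], hence is nonnegative. *)
  have b0 : 0 <= beta i by apply: le_trans (gb p p _ Sy).
  have := interpolation_error x i g _ lam g2 b0 gb lam0 lam1.
  rewrite -yE gf //; under eq_bigr => j _.
    by rewrite gf; [over|exact: simplex_vertex].
  by [].
have term p : (f y + Gu (G y) u) 0 p * gradW x Wv i p 0 <=
    \sum_j lam j * (f (x i j) 0 p * gradW x Wv i p 0) +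
    l i 0 p * (beta i * C + ghat i * uhat).
  rewrite mxE; set w := gradW x Wv i p 0.
  have : (f y 0 p - \sum_j lam j * f (x i j) 0 p + Gu (G y) u 0 p) * w <=
      l i 0 p * (beta i * C + ghat i * uhat).
    apply: le_trans (ler_norm _) _; rewrite normrM mulrC.
    apply: ler_pM => //; first exact: gl.
    apply: le_trans (ler_normD _ _) _; apply: lerD (fp p) _.
    exact: Gu_le (Gghat _ _ Sy) uu (ltW uhat0) p.
  have -> : \sum_j lam j * (f (x i j) 0 p * w) = (\sum_j lam j * f (x i j) 0 p) * w.
    by rewrite mulr_suml; apply: eq_bigr => j _; rewrite mulrA.
  lra.
have : \sum_j lam j * Dij x f beta ghat Wv l uhat i j <= - b2.
  rewrite -[leRHS]mul1r -[X in X * _]lam1 mulr_suml; apply: ler_sum => j _.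
  exact: ler_wpM2l.
apply: le_trans; rewrite mxE; apply: le_trans (ler_sum _ (fun p _ => term p)) _.
rewrite big_split exchange_big -mulr_suml /=.
under [X in X + _]eq_bigr do rewrite -mulr_sumr.
under [leRHS]eq_bigr do rewrite /Dij mulrDr.
rewrite big_split /= lerD2l /C.
rewrite le_eqVlt; apply/orP; left; apply/eqP.
under [RHS]eq_bigr => j _.
  rewrite (_ : _ * _ = (\sum_k l i 0 k) * beta i * (lam j * cij x i j) +
    (\sum_k l i 0 k) * ghat i * uhat * lam j); last by ring.
  over.
by rewrite big_split -!mulr_sumr lam1 /=; ring.
Qed.

Context {Omega : set 'rV[R]_n} {W : 'rV[R]_n -> R}.
Hypothesis Xu : forall i, Xmat x i \in unitmx.
Hypothesis cover : [set y | exists i, simplex x i y] = Omega.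
Hypothesis WCPA : is_CPA x Wv W.

(** A convex combination of positive vertex values could vanish only if all weights did, but they
    sum to 1. *)
Lemma CPA_pos y : Omega y -> 0 < W y.
Proof.
have [_ Wv0 _ _] := bc.
rewrite -cover => -[i /simplexP[lam [lam0 lam1 ->]]].
rewrite (CPA_convex_comb x i (Xu i) WCPA) // lt0r; apply/andP; split; last first.
  apply: sumr_ge0 => j _; rewrite mulr_ge0 // ltW // Wv0 //.
  by exists i, j.
have Wp j : 0 < Wv (x i j) by apply: Wv0; exists i, j.
apply: contra_eq_neq lam1 => S0; rewrite big1 => [|j _].
  by rewrite eq_sym oner_neq0.
have /(_ j isT)/eqP := psumr_eq0P (fun k _ => mulr_ge0 (lam0 k) (ltW (Wp k))) S0.
by rewrite mulf_eq0 (gt_eqF (Wp j)) orbF => /eqP.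
Qed.

Lemma dini_le y u : (Omega `\` A1)° y -> norminf u <= uhat ->
  (dini W y (f y + Gu (G y) u) <= (- b2)%:E)%E.
Proof.
move=> Oy uu; set v := f y + _.
have near_in : \forall h \near 0^'+, (Omega `\` A1) (y + h *: v).
  have cv : (fun h : R => y + h *: v) @ 0^'+ --> y.
    apply: cvg_at_right_filter.
    rewrite -[X in _ --> X]addr0 -(scale0r v).
    by apply: cvgD; [exact: cvg_cst|apply: cvgZr_tmp; exact: cvg_id].
  exact: cv Oy.
(* Finiteness of the triangulation gives one threshold on [h] valid for all simplexes. *)
have near_mem : \forall h \near 0^'+,
    forall i, simplex x i (y + h *: v) -> simplex x i y.
  apply: filter_forall => i; have [Sy|nSy] := pselect (simplex x i y).
    by near=> h.
  by near=> h => Sh; exfalso; move: Sh; near: h; exact: simplex_line_near.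
have : \forall h \near 0^'+, (((W (y + h *: v) - W y) / h)%:E <= (- b2)%:E)%E.
  near=> h.
  have h0 : 0 < h by near: h; exact: nbhs_right_gt.
  have [] : (Omega `\` A1) (y + h *: v) by near: h.
  (* The simplex may vary with [h]. It contains both [y] and the moved point, and the latter lies
     outside [A1], so the gradient bound applies to it. *)
  rewrite -cover => -[i Si] nA.
  have Sy : simplex x i y by move: i Si; near: h.
  have iA : ~ (simplex x i `<=` A1) by move=> /(_ _ Si).
  have WE : W (y + h *: v) - W y = (v *m gradW x Wv i) 0 0 * h.
    rewrite !(CPA_grad x i WCPA) // (addrAC y) mulmxDl -scalemxAl.
    by rewrite mxE [X in _ + (_ + X)]mxE; ring.
  by rewrite lee_fin ler_pdivrMr // WE ler_pM2r // grad_flow_le.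
move=> H; rewrite /dini limf_esupE.
(* The upper limit is an infimum of suprema over neighbourhoods, so the supremum over this one set
   bounds it. *)
apply: (@le_trans _ _ (ereal_sup ((fun h : R => ((W (y + h *: v) - W y) / h)%:E) @`
   [set h | (((W (y + h *: v) - W y) / h)%:E <= (- b2)%:E)%E]))).
  by apply: ereal_inf_lbound; eexists; [exact: H|].
by apply: ge_ereal_sup => _ [h Hh <-].
Unshelve. all: by end_near. Qed.

End Barrier.

Theorem theorem2 (R : realType) (n m mT : nat) (Omega : set 'rV[R]_n)
    (f : 'rV[R]_n -> 'rV[R]_n) (G : 'rV[R]_n -> 'M[R]_(n, m))
    (kappa : R -> 'rV[R]_m)
    (x : 'I_mT -> 'I_n.+1 -> 'rV[R]_n) (A1 : set 'rV[R]_n)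
    (beta ghat : 'I_mT -> R) :
  frakR Omega ->
  f 0 = 0 ->
  triangulation Omega x ->
  (forall p : 'I_n, pwC2 Omega x (fun y => f y 0 p)) ->
  (forall (p : 'I_n) (k : 'I_m), pwC2 Omega x (fun y => G y p k)) ->
  frakR A1 -> A1 `<=` Omega ->
  bdry A1 `<=` [set y | exists i, bdry (simplex x i) y] ->
  (* beta_i bounds all second partials of f on sigma_i *)
  (forall i (p q r : 'I_n) (g : 'rV[R]_n -> R),
      C2 g -> (forall y, simplex x i y -> g y = f y 0 p) ->
      forall xi, simplex x i xi -> `|partial (partial g q) r xi| <= beta i) ->
  (* ghat_i = max over sigma_i of ||G||_oo *)
  (forall i, (forall y, simplex x i y -> mxnorminf (G y) <= ghat i) /\
             exists2 y, simplex x i y & mxnorminf (G y) = ghat i) ->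
  (exists (Wv : 'rV[R]_n -> R) (l : 'I_mT -> 'rV[R]_n) (b2 uhat : R),
      barrier_conditions x f beta ghat A1 Wv l b2 uhat) /\
  (forall (Wv : 'rV[R]_n -> R) (l : 'I_mT -> 'rV[R]_n) (b2 uhat : R),
      barrier_conditions x f beta ghat A1 Wv l b2 uhat ->
      0 < b2 ->
      forall W : 'rV[R]_n -> R, is_CPA x Wv W ->
      forall c : R,
      A1 `<=` [set y | Omega y /\ W y <= c] ->
      [set y | Omega y /\ W y <= c] `<=` Omega ->
      (forall t, 0 <= t -> norminf (kappa t) <= uhat) ->
      [/\ (exists L : R, forall y z, Omega y -> Omega z ->
             `|W y - W z| <= L * norm2 (y - z)),
          (forall y, Omega y -> 0 < W y) &
          (forall y, (Omega `\` A1)° y ->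
             forall u : 'rV[R]_m, norminf u <= uhat ->
             (dini W y (f y + Gu (G y) u) <= (- b2)%:E)%E)]).
Proof.
move=> _ _ [Xu cover _ _ _] fC2 _ _ _ _ fbeta Gghat; split.
  (* With zero gradients and [l = 0] every [Dij] is 0, whatever [beta] and [ghat] are; [uhat = 1] is
     a positive choice. *)
  exists (fun=> 1), (fun=> 0), 0, 1.
  have g0 i : gradW x (fun=> 1) i = 0.
    rewrite /gradW (_ : Wbar _ _ _ = 0) ?mulmx0 //.
    by apply/colP => k; rewrite !mxE subrr.
  split=> //; first by move=> i k; rewrite g0 !mxE normr0.
  move=> i _ j; rewrite /Dij g0 oppr0 big1 => [|k _]; last by rewrite mxE mulr0.
  by rewrite add0r big1 ?mul0r // => k _; rewrite mxE.
move=> Wv l b2 uhat bc _ W WCPA c _ _ _.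
have fC2' i p := (fC2 p).2 i.
have Gghat' i y := (Gghat i).1 y.
split.
- have [L LP] := CPA_lipschitz x Xu WCPA; exists L => y z.
  by rewrite -cover => -[i Sy] [i' Sz]; exact: LP Sy Sz.
- move=> y Oy; exact: (CPA_pos bc Xu cover WCPA y Oy).
- by move=> y Oy u uu; exact: (dini_le fC2' fbeta Gghat' bc Xu cover WCPA y u Oy uu).
Qed.
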